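(* Let $F$ be a field, let $D$ be a quaternion division algebra over $F$, let $L\subset D$ be a separable quadratic field extension of $F$, and let $c,d\in L\setminus F$. Then, as $F$-algebras: (i) $\mathrm{Cay}(D,c)\not\cong \mathrm{Cay}_r(D,d)$; (ii) $\mathrm{Cay}_m(D,c)\not\cong \mathrm{Cay}(D,d)$; (iii) $\mathrm{Cay}_m(D,c)\not\cong \mathrm{Cay}_r(D,d)$.
   Context: For a quaternion algebra $D$ over $F$ with canonical involution $x\mapsto\bar x$ and $c\in D^\times\setminus F$, the $F$-vector space $D\oplus D$ becomes a unital nonassociative $F$-algebra with unit $(1,0)$ under each of the following multiplications ($u,v,u',v'\in D$): $\mathrm{Cay}(D,c)$: $(u,v)(u',v')=(uu'+c\,\bar{v'}v,\ v'u+v\bar{u'})$; $\mathrm{Cay}_m(D,c)$: $(u,v)(u',v')=(uu'+\bar{v'}cv,\ v'u+v\bar{u'})$; $\mathrm{Cay}_r(D,c)$: $(u,v)(u',v')=(uu'+\bar{v'}v\,c,\ v'u+v\bar{u'})$. *)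

(* Defs.v *)
(* Mathematical Components world. *)
From mathcomp Require Import all_boot all_order all_algebra all_field.

Set Implicit Arguments.
Unset Strict Implicit.
Unset Printing Implicit Defensive.

Import GRing.Theory.
Local Open Scope ring_scope.

Section Quaternion.
Variables (F : fieldType) (D : falgType F).

(* A two-sided ideal of a unital algebra is automatically a subspace, so
   simplicity can be tested on {vspace D}. *)
Definition simple_algebra : Prop :=
  forall I : {vspace D},
    ({:D} * I <= I)%VS -> (I * {:D} <= I)%VS -> I = 0%VS \/ I = {:D}%VS.

Definition central_algebra : Prop := ('Z({:D}) = 1)%VS.

Definition quaternion_algebra : Prop :=
  [/\ central_algebra, simple_algebra & \dim {:D} = 4%N].

Definition division_algebra : Prop :=
  forall x : D, x != 0 -> x \is a GRing.unit.

(* On a quaternion algebra exactly one F-linear involution has all its traces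
   x + bar x and norms x * bar x in F = F.1; this holds in every
   characteristic. *)
Definition canonical_involution (bar : {linear D -> D}) : Prop :=
  [/\ {morph bar : x y / x * y >-> y * x},
      involutive bar,
      forall x, x + bar x \in 1%VS
    & forall x, x * bar x \in 1%VS].

Variable bar : D -> D.

Definition Cay (c : D) (x y : D * D) : D * D :=
  let: (u, v) := x in let: (u', v') := y in
  (u * u' + c * bar v' * v, v' * u + v * bar u').

Definition Cay_m (c : D) (x y : D * D) : D * D :=
  let: (u, v) := x in let: (u', v') := y in
  (u * u' + bar v' * c * v, v' * u + v * bar u').

Definition Cay_r (c : D) (x y : D * D) : D * D :=
  let: (u, v) := x in let: (u', v') := y in
  (u * u' + bar v' * v * c, v' * u + v * bar u').

End Quaternion.

(* A nonassociative F-algebra is given by its underlying F-module together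
   with its multiplication.  Preservation of the unit by a multiplicative
   bijection between unital algebras is automatic. *)
Definition isomorphic_algebras (F : fieldType) (A B : lmodType F)
    (mulA : A -> A -> A) (mulB : B -> B -> B) : Prop :=
  exists f : {linear A -> B},
    bijective f /\ {morph f : x y / mulA x y >-> mulB x y}.

(* Main.v *)
(* In each of the three algebras, an element (u, v) satisfies a quadratic
   equation over F exactly when v = 0: its square minus t(u) (u, v) is a scalar
   plus the square of (0, v), which for v <> 0 is a nonzero scalar times a
   conjugate of c.  So an isomorphism f preserves D + 0 and restricts there to an
   automorphism g of D.  Since (0, 1) a = (bar a) (0, 1), the image (p, q) of
   (0, 1) satisfies p (g a) = g (bar a) p, which forces p = 0 as c is not
   central; hence f (u, v) = (g u, q (g v)).  Comparing products of elements of
   0 + D then gives g c = n(q) d with d, hence c, central, a contradiction. *)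
Require Import Defs.
From mathcomp Require Import all_boot all_order all_algebra all_field.

Set Implicit Arguments.
Unset Strict Implicit.
Unset Printing Implicit Defensive.

Import GRing.Theory.
Local Open Scope ring_scope.

(** The three multiplications share this shape and differ only in the product [P] of two elements of
    [0 + D], so isomorphisms between them can be analysed once. *)
Definition doubling (F : fieldType) (D : falgType F) (bar : D -> D)
    (P : D -> D -> D) (x y : D * D) : D * D :=
  let: (u, v) := x in let: (u', v') := y in
  (u * u' + P v v', v' * u + v * bar u').

Section DivisionAlgebra.
Variables (F : fieldType) (D : falgType F).
Hypothesis Ddiv : division_algebra D.

Lemma division_mulI (x : D) : x != 0 -> injective ( *%R x).
Proof. by move=> /Ddiv /mulrI. Qed.

Lemma division_mul_neq0 (x y : D) : x != 0 -> y != 0 -> x * y != 0.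
Proof.
move=> x0; apply: contra => /eqP xy0; apply/eqP/(division_mulI x0).
by rewrite mulr0.
Qed.

Lemma scalar_mulr_cancel (x y : D) :
  y != 0 -> y \in 1%VS -> x * y \in 1%VS -> x \in 1%VS.
Proof.
move=> y0 /vlineP[k yE]; rewrite yE -scalerAr mulr1 => /vlineP[l xE].
have k0 : k != 0 by apply: contraNneq y0 => k0; rewrite yE k0 scale0r.
by apply/vlineP; exists (k^-1 * l); rewrite -scalerA -xE scalerA mulVf ?scale1r.
Qed.

Lemma central_scalar (x : D) :
  central_algebra D -> (forall y, x * y = y * x) -> x \in 1%VS.
Proof.
by move=> <- xC; rewrite memv_cap memvf; apply/centvP => y _; rewrite xC.
Qed.

Variable bar : {linear D -> D}.
Hypothesis barP : canonical_involution bar.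

Lemma barM : {morph bar : x y / x * y >-> y * x}.
Proof. by case: barP. Qed.

Lemma barK : involutive bar.
Proof. by case: barP. Qed.

Lemma bar1 : bar 1 = 1.
Proof. by rewrite -[LHS]mul1r -{1}(barK 1) -barM mul1r barK. Qed.

Lemma bar_neq0 (x : D) : x != 0 -> bar x != 0.
Proof. by apply: contraNneq => x0; rewrite -(barK x) x0 linear0. Qed.

Lemma bar_trace (x : D) : exists t : F, x + bar x = t *: 1.
Proof. by apply/vlineP; case: barP. Qed.

(** By the trace, [bar x] is a scalar minus [x]. *)
Lemma mul_barC (x : D) : bar x * x = x * bar x.
Proof.
have [t xt] := bar_trace x; have -> : bar x = t *: 1 - x by rewrite -xt addrC addKr.
by rewrite mulrBl mulrBr -scalerAl -scalerAr mul1r mulr1.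
Qed.

Lemma bar_mul_scalar (x : D) : bar x * x \in 1%VS.
Proof. by rewrite mul_barC; case: barP. Qed.

Definition quadratic_element (P : D -> D -> D) (x : D * D) : Prop :=
  exists a b : F, doubling bar P x x = a *: x + b *: (1, 0).

(** The last condition keeps the square of [(0, v)] outside [F] for nonzero [v]. *)
Definition doubling_form (P : D -> D -> D) : Prop :=
  [/\ forall v, P 0 v = 0, forall v, P v 0 = 0
    & forall v, v != 0 -> P v v \notin 1%VS].

Lemma quadratic_elementP (P : D -> D -> D) (u v : D) :
  doubling_form P -> quadratic_element P (u, v) <-> v = 0.
Proof.
move=> [P0l _ Pn]; split=> [[a [b [E1 E2]]]|->].
  apply/eqP/negPn/negP => v0; move/negP: (Pn v v0); apply.
  (* The second components read [v (u + bar u) = a v], so [a] is the trace of [u]. *)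
  have au : u + bar u = a *: 1.
    apply: (division_mulI v0).
    by rewrite mulrDr E2 scaler0 addr0 -scalerAr mulr1.
  have -> : P v v = bar u * u + b *: 1.
    apply: (addrI (u * u)); rewrite E1 addrA -mulrDl au.
    by rewrite -scalerAl mul1r.
  by rewrite memvD ?bar_mul_scalar // memvZ ?memv_line.
have [t ut] := bar_trace u; have /vlineP[n un] := bar_mul_scalar u.
(* The coefficients come from [u^2 = t u - n], with [t] the trace and [n] the norm of [u]. *)
exists t, (- n); congr (_, _) => /=; last first.
  by rewrite !mul0r !scaler0 addr0.
by rewrite P0l addr0 scaleNr -un -[u in t *: u]mul1r scalerAl -ut mulrDl addrK.
Qed.

Lemma doubling_iso (P Q : D -> D -> D) (c : D) :
  central_algebra D -> c \notin 1%VS -> doubling_form P -> doubling_form Q ->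
  isomorphic_algebras (doubling bar P) (doubling bar Q) ->
  exists (g : D -> D) (q : D),
    [/\ injective g, {morph g : x y / x * y}, q != 0,
        forall x, g (bar x) = bar (g x)
      & forall v w, g (P v w) = Q (q * g v) (q * g w)].
Proof.
move=> Dc cF Pf Qf [f [[f' fK f'K] fM]].
have [[P0l P0r _] [Q0l Q0r _]] := (Pf, Qf).
have f1 : f (1, 0) = (1, 0).
  have mul1 x : doubling bar P (1, 0) x = x.
    by case: x => u v /=; rewrite P0l addr0 mul0r mulr1 mul1r addr0.
  have mulx1 x : doubling bar Q x (1, 0) = x.
    by case: x => u v /=; rewrite Q0r addr0 mul0r bar1 !mulr1 add0r.
  (* As [f] is onto, [f (1, 0)] is a left unit, hence equal to the right unit [(1, 0)]. *)
  by rewrite -[LHS]mulx1 -{2}(f'K (1, 0)) -fM mul1 f'K.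
have fquad x : quadratic_element P x <-> quadratic_element Q (f x).
  split=> -[a [b E]]; exists a, b.
    by rewrite -fM E linearD !linearZ_LR f1.
  apply: (can_inj fK).
  by rewrite fM E linearD !linearZ_LR f1.
pose g u := (f (u, 0)).1.
have fg u : f (u, 0) = (g u, 0).
  have /fquad : quadratic_element P (u, 0) by apply/quadratic_elementP.
  by rewrite /g; case: (f _) => a b /(quadratic_elementP _ _ Qf) ->.
have gM : {morph g : x y / x * y}.
  move=> x y; have := fM (x, 0) (y, 0).
  rewrite /= P0l !mul0r !addr0 !fg /= Q0l !mul0r !addr0.
  by case.
have gI : injective g.
  by move=> x y gxy; have := fg x; rewrite gxy -fg => /(can_inj fK) [].
case Epq: (f (0, 1)) => [p q].
have q0 : q != 0.
  apply/negP => /eqP qz; have : quadratic_element P (0, 1).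
    by apply/fquad; rewrite Epq; apply/quadratic_elementP.
  by move/(quadratic_elementP _ _ Pf)/eqP; rewrite oner_eq0.
(* Since [(0, v)] is both [(v, 0) (0, 1)] and [(0, 1) (bar v, 0)], its image can be computed twice;
   comparing components yields [gbar] and [pg]. *)
have fr v : f (0, v) = (g v * p, q * g v).
  have := fM (v, 0) (0, 1).
  by rewrite /= P0l mulr0 mul0r mul1r !addr0 fg Epq /= Q0l mul0r !addr0.
have fl a : f (0, bar a) = (p * g a, q * bar (g a)).
  have := fM (0, 1) (a, 0).
  by rewrite /= P0r !mul0r mul1r !add0r fg Epq /= Q0r mul0r addr0 add0r.
have gbar a : g (bar a) = bar (g a).
  by have := fl a; rewrite fr => -[_ /(division_mulI q0)].
have pg a : p * g a = g (bar a) * p by have := fl a; rewrite fr => -[-> _].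
have p0 : p = 0.
  (* For nonzero [p], conjugating [g] by [p] would preserve products, yet by [pg] it reverses them;
     [c] would then commute with everything. *)
  apply/eqP/negPn/negP => pn0; move/negP: cF; apply.
  apply: (central_scalar Dc) => x; apply/gI/(division_mulI pn0).
  by rewrite pg barM gM -mulrA -pg mulrA -pg -mulrA -gM.
exists g, q; split=> // v w.
have := fM (0, v) (0, w).
rewrite /= !mulr0 linear0 mulr0 !add0r fg !fr p0 !mulr0 /=.
by rewrite linear0 !mulr0 !add0r; case.
Qed.

Lemma Cay_form (c : D) : c \notin 1%VS ->
  doubling_form (fun v v' => c * bar v' * v).
Proof.
move=> cF; split=> [v|v|v v0]; rewrite ?linear0 ?mulr0 ?mul0r //.
apply: contra cF; rewrite -mulrA; apply: scalar_mulr_cancel.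
  by rewrite division_mul_neq0 ?bar_neq0.
exact: bar_mul_scalar.
Qed.

Lemma Cay_m_form (c : D) : c \notin 1%VS ->
  doubling_form (fun v v' => bar v' * c * v).
Proof.
move=> cF; split=> [v|v|v v0]; rewrite ?linear0 ?mulr0 ?mul0r //.
apply: contra cF => /vlineP[k E].
have v'0 := bar_neq0 v0.
apply: (@scalar_mulr_cancel c (bar v * v)).
- exact: division_mul_neq0.
- exact: bar_mul_scalar.
(* Cancel [bar v] on the left of [bar v c v bar v = k bar v]. *)
apply/vlineP; exists k; apply: (division_mulI v'0).
by rewrite mul_barC !mulrA E -!scalerAl -scalerAr mul1r mulr1.
Qed.

Lemma Cay_r_form (c : D) : c \notin 1%VS ->
  doubling_form (fun v v' => bar v' * v * c).
Proof.
move=> cF; split=> [v|v|v v0]; rewrite ?linear0 ?mulr0 ?mul0r //.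
have /vlineP[n nE] := bar_mul_scalar v.
apply: contra cF; rewrite nE -scalerAl mul1r -[c in n *: c]mulr1 scalerAr -nE.
apply: scalar_mulr_cancel; last exact: bar_mul_scalar.
by rewrite division_mul_neq0 ?bar_neq0.
Qed.

Hypothesis Dcentral : central_algebra D.
Variables c d : D.
Hypotheses (cF : c \notin 1%VS) (dF : d \notin 1%VS).

(** In a division algebra the idempotent [g 1] is 0 or 1, and 0 is already [g 0] in that case. *)
Lemma injective_morph1 (g : D -> D) :
  injective g -> {morph g : x y / x * y} -> g 1 = 1.
Proof.
move=> gI gM; case: (eqVneq (g 1) 0) => [g0|/division_mulI]; last first.
  by apply; rewrite mulr1 -gM mulr1.
have : g 0 = g 1 by rewrite -[0](mulr1 0) gM g0 mulr0.
by move/gI/eqP; rewrite eq_sym oner_eq0.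
Qed.

(** This extracts the unknown factor [q] from the second product as its norm [n]. *)
Lemma mul_bar_scalar (q x y : D) (n : F) :
  bar q * q = n *: 1 -> bar (q * x) * (q * y) = n *: (bar x * y).
Proof.
by move=> nE; rewrite barM mulrA -(mulrA _ (bar q)) nE -scalerAr mulr1 scalerAl.
Qed.

Lemma Cay_not_iso_Cay_r : ~ isomorphic_algebras (Cay bar c) (Cay_r bar d).
Proof.
move=> /(doubling_iso Dcentral cF (Cay_form cF) (Cay_r_form dF)).
move=> [g [q [gI gM q0 gbar gP]]].
have /vlineP[n nE] := bar_mul_scalar q; have g1 := injective_morph1 gI gM.
(* Here [c] and [d] stand on opposite sides of [x]. At [x = 1] this gives [g c = n d], whence
   [g (c x) = g x g c = g (x c)]. *)
have E x : g (c * x) = n *: (g x * d).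
  have := gP 1 (bar x).
  by rewrite barK mulr1 (mul_bar_scalar _ _ nE) -gbar barK g1 mulr1 -scalerAl.
have gc : g c = n *: d by rewrite -[c]mulr1 E g1 mul1r.
move/negP: cF; apply; apply: central_scalar => // x.
by apply: gI; rewrite E gM gc -scalerAr.
Qed.

Lemma Cay_m_not_iso_Cay : ~ isomorphic_algebras (Cay_m bar c) (Cay bar d).
Proof.
move=> /(doubling_iso Dcentral cF (Cay_m_form cF) (Cay_form dF)).
move=> [g [q [gI gM q0 gbar gP]]].
have /vlineP[n nE] := bar_mul_scalar q; have g1 := injective_morph1 gI gM.
(* Choosing [v = 1] leaves [c] on the right of [x], opposite to [d]. *)
have E x : g (x * c) = n *: (d * g x).
  have := gP 1 (bar x).
  rewrite barK mulr1 -mulrA (mul_bar_scalar _ _ nE).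
  by rewrite -gbar barK g1 mulr1 -scalerAr.
have gc : g c = n *: d by rewrite -[c]mul1r E g1 mulr1.
move/negP: cF; apply; apply: central_scalar => // x.
by apply: gI; rewrite E gM gc -scalerAl.
Qed.

Lemma Cay_m_not_iso_Cay_r : ~ isomorphic_algebras (Cay_m bar c) (Cay_r bar d).
Proof.
move=> /(doubling_iso Dcentral cF (Cay_m_form cF) (Cay_r_form dF)).
move=> [g [q [gI gM q0 gbar gP]]].
have /vlineP[n nE] := bar_mul_scalar q; have g1 := injective_morph1 gI gM.
(* Now [w = 1] is chosen, so that [c] lands on the left of [x] and [d] on the right. *)
have E x : g (c * x) = n *: (g x * d).
  have := gP x 1.
  by rewrite bar1 mul1r (mul_bar_scalar _ _ nE) g1 bar1 mul1r -scalerAl.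
have gc : g c = n *: d by rewrite -[c]mulr1 E g1 mul1r.
move/negP: cF; apply; apply: central_scalar => // x.
by apply: gI; rewrite E gM gc -scalerAr.
Qed.

End DivisionAlgebra.

(** A morphism out of a field is injective, and [iota] fixes the scalars. *)
Lemma lrmorph_notin1 (F : fieldType) (L : fieldExtType F) (D : falgType F)
    (iota : {lrmorphism L -> D}) (c : L) :
  c \notin 1%VS -> iota c \notin 1%VS.
Proof.
apply: contra => /vlineP[k E]; apply/vlineP; exists k.
apply: (fmorph_inj iota); apply: (etrans E).
by rewrite -[in LHS](rmorph1 iota) -linearZ_LR.
Qed.

Theorem theorem19 (F : fieldType) (D : falgType F) (bar : {linear D -> D})
    (L : fieldExtType F) (iota : {lrmorphism L -> D}) (c d : L) :
  quaternion_algebra D ->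
  division_algebra D ->
  canonical_involution bar ->
  \dim {:L} = 2%N ->
  separable 1 {:L} ->
  c \notin 1%VS ->
  d \notin 1%VS ->
  [/\ ~ isomorphic_algebras (Cay bar (iota c)) (Cay_r bar (iota d)),
      ~ isomorphic_algebras (Cay_m bar (iota c)) (Cay bar (iota d))
    & ~ isomorphic_algebras (Cay_m bar (iota c)) (Cay_r bar (iota d))].
Proof.
move=> [Dc _ _] Ddiv barP _ _.
move=> /(lrmorph_notin1 iota) cF /(lrmorph_notin1 iota) dF.
split; [exact: Cay_not_iso_Cay_r | exact: Cay_m_not_iso_Cay |].
exact: Cay_m_not_iso_Cay_r.
Qed.
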